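(* Let $u(x,t)>0$ be smooth on $S^1\times[0,1]$ with $\int_{S^1}u(\cdot,t)=1$, and let $f=u_t$. The canonical geodesic equation $$f_t=\tilde U_x,\qquad\tilde U=\frac{Q(f)f}{u}+\frac u2\Big[\frac{Q(f)^2}{u^2}\Big]_x,$$ is equivalent to each of the following: (1) the equation of the canonical form $Q(f)_t=\tilde U$; (2) the inviscid Burgers equation $q_t+qq_x=0$, where $q=-Q(f)u^{-1}$; (3) the Hamilton–Jacobi equation $\phi_t+\frac{|\phi_x|^2}2=B$, where $\phi$ is a function with $q=\phi_x$ and $B=B(t)$ is the value of $\phi_t+\frac12|\phi_x|^2$ at $x=0$.
   Context: $S^1=\mathbb R/\mathbb Z$ (unit length) with coordinate $x$. For a smooth zero-mean function $f$ on $S^1$ with $F(x)=\int_0^xf$, $Q(f)=F-\big[\int_{S^1}u^{-1}F\big]\big[\int_{S^1}u^{-1}\big]^{-1}$ (with $u=u(\cdot,t)$), so $Q(f)_x=f$ and $\int_{S^1}u^{-1}Q(f)=0$; in particular $q=-Q(f)/u$ has zero mean and admits a periodic primitive $\phi$. *)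

(* Defs.v *)
From Stdlib Require Import Reals Lra.
From Coquelicot Require Import Coquelicot.
Open Scope R_scope.

(* A function on S^1 x [0,1], with S^1 = R/Z, is a map g : R -> R -> R (space
   variable first) that is 1-periodic in space; only its values at times in
   [0,1] matter. *)

Definition I01 (t : R) : Prop := 0 <= t <= 1.

Definition periodic (g : R -> R -> R) : Prop :=
  forall x t, I01 t -> g (x + 1) t = g x t.

Definition dx (g : R -> R -> R) (x t : R) : R := Derive (fun y => g y t) x.

(* Time derivatives are taken within [0,1], hence one-sided at t = 0 and t = 1;
   for t outside [0,1] the value of [dt g x t] is irrelevant. *)
Definition is_dt (g : R -> R -> R) (x t l : R) : Prop :=
  D_in (g x) (fun _ => l) I01 t.

Definition ex_dt (g : R -> R -> R) (x t : R) : Prop :=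
  exists l, is_dt g x t l.

Definition dt (g : R -> R -> R) (x t : R) : R := iota (is_dt g x t).

Lemma is_dt_unique (g : R -> R -> R) (x t l : R) :
  I01 t -> is_dt g x t l -> dt g x t = l.
Proof.
intros Ht Hl; apply (iota_unique (V := R_CompleteNormedModule) (is_dt g x t));
  [|exact Hl].
intros l' Hl'; apply (single_limit _ _ _ _ t) with (2 := Hl') (3 := Hl).
unfold I01 in Ht; intros a Ha.
assert (Hm : 0 < Rmin (a / 2) (1 / 2)) by (apply Rmin_pos; lra).
pose proof (Rmin_l (a / 2) (1 / 2)); pose proof (Rmin_r (a / 2) (1 / 2)).
destruct (Rle_dec t (1 / 2)).
- exists (t + Rmin (a / 2) (1 / 2)); unfold D_x, I01, Rdist; repeat split; try lra.
  rewrite Rabs_pos_eq; lra.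
- exists (t - Rmin (a / 2) (1 / 2)); unfold D_x, I01, Rdist; repeat split; try lra.
  rewrite Rabs_left; lra.
Qed.

(* All mixed partial derivatives of order at most n exist and are jointly
   continuous on R x [0,1], boundary times included. *)
Fixpoint Ck (n : nat) (g : R -> R -> R) : Prop :=
  continuous_on (fun p : R * R => I01 (snd p)) (fun p => g (fst p) (snd p)) /\
  match n with
  | O => True
  | S m =>
      (forall x t, I01 t -> ex_derive (fun y => g y t) x /\ ex_dt g x t) /\
      Ck m (dx g) /\ Ck m (dt g)
  end.

Definition smooth (g : R -> R -> R) : Prop := forall n, Ck n g.

(* Integrals over S^1 are integrals over the fundamental domain [0,1]. *)
Definition Q (u f : R -> R -> R) (x t : R) : R :=
  let F := fun y => RInt (fun z => f z t) 0 y in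
  F x - RInt (fun y => / u y t * F y) 0 1 * / RInt (fun y => / u y t) 0 1.

Definition Utilde (u f : R -> R -> R) (x t : R) : R :=
  Q u f x t * f x t / u x t
  + u x t / 2 * dx (fun y s => Q u f y s ^ 2 / u y s ^ 2) x t.

Definition q (u f : R -> R -> R) (x t : R) : R := - Q u f x t * / u x t.

Definition geodesic_eq (u f : R -> R -> R) : Prop :=
  forall x t, I01 t -> dt f x t = dx (Utilde u f) x t.

Definition canonical_eq (u f : R -> R -> R) : Prop :=
  forall x t, I01 t -> dt (Q u f) x t = Utilde u f x t.

Definition burgers_eq (v : R -> R -> R) : Prop :=
  forall x t, I01 t -> dt v x t + v x t * dx v x t = 0.

(* No regularity in time is asked of a potential beyond the existence of the
   derivative that occurs in the Hamilton-Jacobi equation. *)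
Definition potential (v phi : R -> R -> R) : Prop :=
  periodic phi /\
  forall x t, I01 t ->
    is_derive (fun y => phi y t) x (v x t) /\ ex_dt phi x t.

Definition hamilton_jacobi_eq (phi : R -> R -> R) : Prop :=
  let B := fun t => dt phi 0 t + Rabs (dx phi 0 t) ^ 2 / 2 in
  forall x t, I01 t -> dt phi x t + Rabs (dx phi x t) ^ 2 / 2 = B t.

(* Main.v *)
(** Write Q for Q(f), U for the right-hand side potential of the geodesic equation
    and q = - Q / u.  A direct computation gives
    [q_t + q q_x = - (Q_t - U) / u], so the canonical and the Burgers equation
    are the same.  Since Q_x = f and mixed derivatives commute, the geodesic
    equation says that Q_t - U depends on t only; this function of t vanishes
    because the integral of q_t + q q_x over the circle is zero, q having zero
    mean.  A potential of q is its value at x = 0 plus the integral of q from 0,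
    hence the x-derivative of the Hamilton-Jacobi equation is the Burgers
    equation. *)

Require Import Defs.
From Stdlib Require Import Reals Lra.
From Coquelicot Require Import Coquelicot.
Open Scope R_scope.

(** * One-sided time derivatives and their two-sided extensions *)

(** The retraction of the line onto [0,1]. Precomposing with it in time replaces a function on the
    strip by one on the whole plane, to which the two-variable continuity lemmas apply without any
    domain condition. *)
Definition clamp (t : R) : R := Rmax 0 (Rmin t 1).

Lemma clamp_I01 (t : R) : I01 (clamp t).
Proof. unfold clamp, I01, Rmax, Rmin; repeat destruct Rle_dec; lra. Qed.

Lemma clamp_id (t : R) : I01 t -> clamp t = t.
Proof. unfold clamp, I01, Rmax, Rmin; repeat destruct Rle_dec; lra. Qed.

Lemma clamp_lipschitz (s t : R) : Rabs (clamp s - clamp t) <= Rabs (s - t).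
Proof.
unfold clamp, Rmax, Rmin, Rabs; repeat destruct Rle_dec; repeat destruct Rcase_abs; lra.
Qed.

(** One direction composes with [clamp], which is 1-Lipschitz with values in [0,1]; the other
    restricts to the strip, where [clamp] is the identity. *)
Lemma continuous_on_clamp (g : R -> R -> R) :
  continuous_on (fun p : R * R => I01 (snd p)) (fun p => g (fst p) (snd p)) <->
  forall x t, continuity_2d_pt (fun y s => g y (clamp s)) x t.
Proof.
split.
- intros Hg x t; apply continuity_2d_pt_filterlim.
  apply (filterlim_comp _ _ _ (fun z => (fst z, clamp (snd z)))
           (fun p => g (fst p) (snd p)) _ _ _) with (2 := Hg (x, clamp t) (clamp_I01 t)).
  intros P [eps HP]; exists eps; intros [y s] [Hy Hs]; simpl in *.
  apply HP; [split; [exact Hy|]|apply clamp_I01].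
  apply Rle_lt_trans with (2 := Hs); apply clamp_lipschitz.
- intros Hg [x t] Ht; simpl in Ht.
  pose proof (proj1 (continuity_2d_pt_filterlim _ x t) (Hg x t)) as H.
  simpl in H; rewrite (clamp_id t Ht) in H.
  intros P HP; destruct (H P HP) as [eps Heps]; exists eps.
  intros [y s] Hb Is; specialize (Heps (y, s) Hb); simpl in *.
  rewrite (clamp_id s Is) in Heps; exact Heps.
Qed.

(* Extending by tangent lines beyond [0,1] turns derivatives within [0,1] into
   two-sided ones. *)
Lemma is_derive_tangent_extension (a b : R -> R) (t : R) :
  I01 t -> D_in a b I01 t ->
  is_derive (fun s => a (clamp s) + b (clamp s) * (s - clamp s)) t (b t).
Proof.
intros Ht H; apply is_derive_Reals; intros eps Heps.
destruct (H eps Heps) as [d [Hd H']]; simpl in H'.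
(* With a radius [m] of this kind, [t + h] can leave [0,1] only through an endpoint at which [t]
   already sits. *)
assert (Hm : exists m, 0 < m /\ m <= d /\ (0 < t -> m <= t) /\ (t < 1 -> m <= 1 - t)).
{ unfold I01 in Ht; destruct (Req_dec t 0); [|destruct (Req_dec t 1)].
  - exists (Rmin d 1); pose proof (Rmin_l d 1); pose proof (Rmin_r d 1).
    split; [apply Rmin_pos; lra|lra].
  - exists (Rmin d 1); pose proof (Rmin_l d 1); pose proof (Rmin_r d 1).
    split; [apply Rmin_pos; lra|lra].
  - exists (Rmin d (Rmin t (1 - t))).
    pose proof (Rmin_l d (Rmin t (1 - t))); pose proof (Rmin_r d (Rmin t (1 - t))).
    pose proof (Rmin_l t (1 - t)); pose proof (Rmin_r t (1 - t)).
    split; [repeat apply Rmin_pos; lra|lra]. }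
destruct Hm as [m [m0 [md [mt m1]]]].
exists (mkposreal m m0); simpl; intros h h0 Hh.
rewrite (clamp_id t Ht).
destruct (Rle_dec 0 (t + h)); [destruct (Rle_dec (t + h) 1)|].
- assert (Hth : I01 (t + h)) by (unfold I01; lra).
  rewrite (clamp_id _ Hth).
  specialize (H' (t + h)); unfold D_x, Rdist in H'.
  replace (t + h - t) with h in H' by ring.
  replace (a (t + h) + b (t + h) * (t + h - (t + h)) - (a t + b t * (t - t)))
    with (a (t + h) - a t) by ring.
  apply H'; repeat split; [apply Hth|apply Hth|lra|lra].
- assert (t = 1) by (destruct (Req_dec t 1); [assumption|];
    apply Rabs_def2 in Hh; unfold I01 in Ht; lra).
  subst t; replace (clamp (1 + h)) with 1
    by (unfold clamp, Rmax, Rmin; repeat destruct Rle_dec; lra).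
  (* Past the endpoint the extension is affine with slope [b 1], so the difference quotient has no
     error at all. *)
  match goal with |- Rabs ?e < _ => replace e with 0 by (field; lra) end.
  rewrite Rabs_R0; lra.
- assert (t = 0) by (destruct (Req_dec t 0); [assumption|];
    apply Rabs_def2 in Hh; unfold I01 in Ht; lra).
  subst t; replace (clamp (0 + h)) with 0
    by (unfold clamp, Rmax, Rmin; repeat destruct Rle_dec; lra).
  match goal with |- Rabs ?e < _ => replace e with 0 by (field; lra) end.
  rewrite Rabs_R0; lra.
Qed.

(** Together with [is_derive_is_dt], this transfers each rule of two-sided calculus to derivatives
    within [0,1]: extend, apply the rule, restrict. *)
Lemma is_dt_extension (g : R -> R -> R) (x t l : R) :
  I01 t -> is_dt g x t l ->
  exists h : R -> R, is_derive h t l /\ forall s, I01 s -> h s = g x s.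
Proof.
intros Ht H; exists (fun s => g x (clamp s) + l * (s - clamp s)); split.
- exact (is_derive_tangent_extension _ _ t Ht H).
- intros s Hs; rewrite (clamp_id s Hs); ring.
Qed.

Lemma is_derive_is_dt (g : R -> R -> R) (h : R -> R) (x t l : R) :
  I01 t -> is_derive h t l -> (forall s, I01 s -> h s = g x s) -> is_dt g x t l.
Proof.
intros Ht Hh Hs eps Heps; apply is_derive_Reals in Hh.
destruct (Hh eps Heps) as [d Hd]; exists d; split; [apply cond_pos|].
simpl; unfold D_x, Rdist; intros s [[Is st] Hst].
rewrite <- (Hs s Is), <- (Hs t Ht).
specialize (Hd (s - t)); replace (t + (s - t)) with s in Hd by (simpl in *; lra).
apply Hd; [apply Rminus_eq_contra, not_eq_sym, st|exact Hst].
Qed.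

Lemma is_dt_dt (g : R -> R -> R) (x t : R) :
  I01 t -> ex_dt g x t -> is_dt g x t (dt g x t).
Proof. intros Ht [l Hl]; rewrite (is_dt_unique g x t l Ht Hl); exact Hl. Qed.

(** The two base points may differ, which serves both for periodicity ([x] against [x + 1]) and for
    functions constant in space. *)
Lemma is_dt_ext (g h : R -> R -> R) (x y t l : R) :
  I01 t -> (forall s, I01 s -> g x s = h y s) -> is_dt g x t l -> is_dt h y t l.
Proof.
intros Ht H Hg; destruct (is_dt_extension g x t l Ht Hg) as [k [Hk Hkg]].
apply (is_derive_is_dt h k y t l Ht Hk).
intros s Is; rewrite (Hkg s Is); apply H, Is.
Qed.

Lemma is_dt_const (c x t : R) : I01 t -> is_dt (fun _ _ => c) x t 0.
Proof.
intros Ht; apply (is_derive_is_dt _ (fun _ => c)); [exact Ht| |reflexivity].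
apply @is_derive_const.
Qed.

Lemma is_dt_plus (g h : R -> R -> R) (x t k l : R) :
  I01 t -> is_dt g x t k -> is_dt h x t l ->
  is_dt (fun y s => g y s + h y s) x t (k + l).
Proof.
intros Ht Hg Hh.
destruct (is_dt_extension g x t k Ht Hg) as [a [Ha Hag]].
destruct (is_dt_extension h x t l Ht Hh) as [b [Hb Hbh]].
apply (is_derive_is_dt _ (fun s => a s + b s)); [exact Ht| |].
- apply @is_derive_plus; assumption.
- intros s Is; rewrite Hag, Hbh by exact Is; reflexivity.
Qed.

Lemma is_dt_mult (g h : R -> R -> R) (x t k l : R) :
  I01 t -> is_dt g x t k -> is_dt h x t l ->
  is_dt (fun y s => g y s * h y s) x t (k * h x t + g x t * l).
Proof.
intros Ht Hg Hh.
destruct (is_dt_extension g x t k Ht Hg) as [a [Ha Hag]].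
destruct (is_dt_extension h x t l Ht Hh) as [b [Hb Hbh]].
apply (is_derive_is_dt _ (fun s => a s * b s)); [exact Ht| |].
- rewrite <- Hag, <- Hbh by exact Ht.
  apply (is_derive_mult a b); [exact Ha|exact Hb|apply Rmult_comm].
- intros s Is; rewrite Hag, Hbh by exact Is; reflexivity.
Qed.

Lemma is_dt_inv (g : R -> R -> R) (x t k : R) :
  I01 t -> g x t <> 0 -> is_dt g x t k ->
  is_dt (fun y s => / g y s) x t (- k * (/ g x t * / g x t)).
Proof.
intros Ht H0 Hg.
destruct (is_dt_extension g x t k Ht Hg) as [a [Ha Hag]].
apply (is_derive_is_dt _ (fun s => / a s)); [exact Ht| |].
- replace (- k * (/ g x t * / g x t)) with (- k / a t ^ 2)
    by (rewrite (Hag t Ht); field; exact H0).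
  apply is_derive_inv; [exact Ha|rewrite (Hag t Ht); exact H0].
- intros s Is; rewrite Hag by exact Is; reflexivity.
Qed.

(** * Algebra of the classes [Ck] *)

(* [h] absorbs the junk values that [dx g] and [dt g] may take outside [0,1]. *)
Lemma Ck_intro (n : nat) (g gx gt : R -> R -> R) :
  (forall x t, continuity_2d_pt (fun y s => g y (clamp s)) x t) ->
  (forall x t, I01 t -> is_derive (fun y => g y t) x (gx x t)) ->
  (forall x t, I01 t -> is_dt g x t (gt x t)) ->
  (forall h, (forall x t, I01 t -> h x t = gx x t) -> Ck n h) ->
  (forall h, (forall x t, I01 t -> h x t = gt x t) -> Ck n h) ->
  Ck (S n) g.
Proof.
intros Hc Hx Ht Cx Ct; split; [apply continuous_on_clamp, Hc|].
split; [intros x t It; split; [exists (gx x t)|exists (gt x t)]; auto|].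
split; [apply Cx|apply Ct]; intros x t It.
- apply is_derive_unique, Hx, It.
- apply is_dt_unique; auto.
Qed.

Lemma Ck_continuous (n : nat) (g : R -> R -> R) :
  Ck n g -> forall x t, continuity_2d_pt (fun y s => g y (clamp s)) x t.
Proof. intros H; apply continuous_on_clamp; destruct n; apply H. Qed.

Lemma Ck_0 (g : R -> R -> R) :
  (forall x t, continuity_2d_pt (fun y s => g y (clamp s)) x t) -> Ck 0 g.
Proof. intros H; split; [apply continuous_on_clamp, H|exact I]. Qed.

Lemma Ck_dx (n : nat) (g : R -> R -> R) : Ck (S n) g -> Ck n (dx g).
Proof. intros H; apply H. Qed.

Lemma Ck_dt (n : nat) (g : R -> R -> R) : Ck (S n) g -> Ck n (dt g).
Proof. intros H; apply H. Qed.

Lemma Ck_is_derive (n : nat) (g : R -> R -> R) (x t : R) :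
  Ck (S n) g -> I01 t -> is_derive (fun y => g y t) x (dx g x t).
Proof. intros H Ht; apply Derive_correct, H, Ht. Qed.

Lemma Ck_is_dt (n : nat) (g : R -> R -> R) (x t : R) :
  Ck (S n) g -> I01 t -> is_dt g x t (dt g x t).
Proof. intros H Ht; apply is_dt_dt; [exact Ht|]; apply H, Ht. Qed.

(** Time derivatives are taken within [0,1] and space derivatives at fixed time, so neither sees the
    values outside the strip. *)
Lemma Ck_ext (n : nat) : forall g h : R -> R -> R,
  (forall x t, I01 t -> h x t = g x t) -> Ck n g -> Ck n h.
Proof.
induction n as [|n IH]; intros g h Hgh Hg.
- apply Ck_0; intros x t.
  apply continuity_2d_pt_ext with (f := fun y s => g y (clamp s)).
  + intros y s; symmetry; apply Hgh, clamp_I01.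
  + apply (Ck_continuous 0 g Hg).
- apply (Ck_intro n h (dx g) (dt g)).
  + intros x t.
    apply continuity_2d_pt_ext with (f := fun y s => g y (clamp s)).
    * intros y s; symmetry; apply Hgh, clamp_I01.
    * apply (Ck_continuous _ g Hg).
  + intros x t It; apply is_derive_ext with (f := fun y => g y t).
    * intros y; symmetry; apply Hgh, It.
    * apply (Ck_is_derive n g x t Hg It).
  + intros x t It; apply (is_dt_ext g h x x t _ It).
    * intros s Is; symmetry; apply Hgh, Is.
    * apply (Ck_is_dt n g x t Hg It).
  + intros k Hk; exact (IH _ _ Hk (Ck_dx n g Hg)).
  + intros k Hk; exact (IH _ _ Hk (Ck_dt n g Hg)).
Qed.

Lemma Ck_pred (n : nat) : forall g : R -> R -> R, Ck (S n) g -> Ck n g.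
Proof.
induction n as [|n IH]; intros g Hg.
- apply Ck_0, (Ck_continuous 1 g Hg).
- split; [apply Hg|]; split; [apply Hg|]; split; apply IH; apply Hg.
Qed.

Lemma Ck_const (c : R) (n : nat) : Ck n (fun _ _ => c).
Proof.
revert c; induction n as [|n IH]; intros c.
- apply Ck_0; intros x t; apply continuity_2d_pt_const.
- apply (Ck_intro n _ (fun _ _ => 0) (fun _ _ => 0)).
  + intros x t; apply continuity_2d_pt_const.
  + intros x t _; apply @is_derive_const.
  + intros x t It; apply is_dt_const, It.
  + intros h Hh; exact (Ck_ext n _ _ Hh (IH 0)).
  + intros h Hh; exact (Ck_ext n _ _ Hh (IH 0)).
Qed.

Lemma Ck_plus (n : nat) : forall g h : R -> R -> R,
  Ck n g -> Ck n h -> Ck n (fun x t => g x t + h x t).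
Proof.
induction n as [|n IH]; intros g h Hg Hh.
- apply Ck_0; intros x t.
  apply (continuity_2d_pt_plus (fun y s => g y (clamp s)) (fun y s => h y (clamp s)));
    apply (Ck_continuous 0); assumption.
- apply (Ck_intro n _ (fun x t => dx g x t + dx h x t) (fun x t => dt g x t + dt h x t)).
  + intros x t.
    apply (continuity_2d_pt_plus (fun y s => g y (clamp s)) (fun y s => h y (clamp s)));
      apply (Ck_continuous (S n)); assumption.
  + intros x t It; apply @is_derive_plus; apply (Ck_is_derive n); assumption.
  + intros x t It; apply is_dt_plus; [exact It| |]; apply (Ck_is_dt n); assumption.
  + intros k Hk; apply (Ck_ext n _ _ Hk), IH; apply Ck_dx; assumption.
  + intros k Hk; apply (Ck_ext n _ _ Hk), IH; apply Ck_dt; assumption.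
Qed.

Lemma Ck_mult (n : nat) : forall g h : R -> R -> R,
  Ck n g -> Ck n h -> Ck n (fun x t => g x t * h x t).
Proof.
induction n as [|n IH]; intros g h Hg Hh.
- apply Ck_0; intros x t.
  apply (continuity_2d_pt_mult (fun y s => g y (clamp s)) (fun y s => h y (clamp s)));
    apply (Ck_continuous 0); assumption.
- apply (Ck_intro n _ (fun x t => dx g x t * h x t + g x t * dx h x t)
                      (fun x t => dt g x t * h x t + g x t * dt h x t)).
  + intros x t.
    apply (continuity_2d_pt_mult (fun y s => g y (clamp s)) (fun y s => h y (clamp s)));
      apply (Ck_continuous (S n)); assumption.
  + intros x t It.
    apply (is_derive_mult (fun y => g y t) (fun y => h y t));
      [| |apply Rmult_comm]; apply (Ck_is_derive n); assumption.
  + intros x t It; apply is_dt_mult; [exact It| |]; apply (Ck_is_dt n); assumption.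
  + intros k Hk; apply (Ck_ext n _ _ Hk), Ck_plus; apply IH;
      (apply Ck_dx || apply Ck_pred); assumption.
  + intros k Hk; apply (Ck_ext n _ _ Hk), Ck_plus; apply IH;
      (apply Ck_dt || apply Ck_pred); assumption.
Qed.

Lemma Ck_opp (n : nat) (g : R -> R -> R) : Ck n g -> Ck n (fun x t => - g x t).
Proof.
intros H; apply Ck_ext with (g := fun x t => -1 * g x t); [intros; ring|].
exact (Ck_mult n _ _ (Ck_const (-1) n) H).
Qed.

Lemma Ck_inv (n : nat) : forall g : R -> R -> R,
  (forall x t, I01 t -> g x t <> 0) -> Ck n g -> Ck n (fun x t => / g x t).
Proof.
induction n as [|n IH]; intros g H0 Hg.
- apply Ck_0; intros x t.
  apply (continuity_2d_pt_inv (fun y s => g y (clamp s)));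
    [apply (Ck_continuous 0), Hg|apply H0, clamp_I01].
- apply (Ck_intro n _ (fun x t => - dx g x t * (/ g x t * / g x t))
                      (fun x t => - dt g x t * (/ g x t * / g x t))).
  + intros x t; apply (continuity_2d_pt_inv (fun y s => g y (clamp s)));
      [apply (Ck_continuous (S n)), Hg|apply H0, clamp_I01].
  + intros x t It.
    replace (- dx g x t * (/ g x t * / g x t)) with (- dx g x t / g x t ^ 2)
      by (field; apply H0, It).
    apply (is_derive_inv (fun y => g y t));
      [apply (Ck_is_derive n); assumption|apply H0, It].
  + intros x t It; apply is_dt_inv; [exact It|apply H0, It|].
    apply (Ck_is_dt n); assumption.
  + intros k Hk; apply (Ck_ext n _ _ Hk).
    apply Ck_mult; [apply Ck_opp, Ck_dx, Hg|].
    apply Ck_mult; apply IH; auto using Ck_pred.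
  + intros k Hk; apply (Ck_ext n _ _ Hk).
    apply Ck_mult; [apply Ck_opp, Ck_dt, Hg|].
    apply Ck_mult; apply IH; auto using Ck_pred.
Qed.

(** Quantities depending on time alone, such as integrals over the circle, thereby stay within the
    two-variable calculus. *)
Lemma Ck_at (x0 : R) (n : nat) : forall g : R -> R -> R,
  Ck n g -> Ck n (fun _ t => g x0 t).
Proof.
assert (Hc : forall m g, Ck m g ->
  forall x t, continuity_2d_pt (fun _ s => g x0 (clamp s)) x t).
{ intros m g Hg x t eps.
  destruct (Ck_continuous m g Hg x0 t eps) as [d Hd]; exists d.
  intros y s _ Hs; apply Hd; [|exact Hs].
  rewrite Rminus_diag, Rabs_R0; apply cond_pos. }
induction n as [|n IH]; intros g Hg.
- apply Ck_0, (Hc 0%nat g Hg).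
- apply (Ck_intro n _ (fun _ _ => 0) (fun _ t => dt g x0 t)).
  + apply (Hc (S n) g Hg).
  + intros x t _; apply @is_derive_const.
  + intros x t It; apply (is_dt_ext g _ x0 x t _ It); [reflexivity|].
    apply (Ck_is_dt n g x0 t Hg It).
  + intros k Hk; exact (Ck_ext n _ _ Hk (Ck_const 0 n)).
  + intros k Hk; exact (Ck_ext n _ _ Hk (IH _ (Ck_dt n g Hg))).
Qed.

(** * Primitives in space: continuity and differentiation under the integral *)

(** At [x = 1] this is the integral over the circle. *)
Definition prim (g : R -> R -> R) (x t : R) : R := RInt (fun z => g z t) 0 x.

Lemma continuity_2d_pt_slice (g : R -> R -> R) (x t : R) :
  continuity_2d_pt g x t -> continuous (fun y => g y t) x.
Proof.
intros H; apply continuity_pt_filterlim.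
intros eps Heps; destruct (H (mkposreal eps Heps)) as [d Hd].
exists d; split; [apply cond_pos|].
simpl; unfold Rdist; intros y [_ Hy]; apply Hd; [exact Hy|].
rewrite Rminus_diag, Rabs_R0; apply cond_pos.
Qed.

Lemma Ck_continuous_slice (n : nat) (g : R -> R -> R) (x t : R) :
  Ck n g -> I01 t -> continuous (fun y => g y t) x.
Proof.
intros Hg It; pose proof (Ck_continuous n g Hg x t) as H.
apply continuity_2d_pt_slice in H; rewrite (clamp_id t It) in H; exact H.
Qed.

Lemma Ck_ex_RInt (n : nat) (g : R -> R -> R) (a b t : R) :
  Ck n g -> I01 t -> ex_RInt (fun z => g z t) a b.
Proof.
intros Hg It; apply @ex_RInt_continuous.
intros z _; apply (Ck_continuous_slice n); assumption.
Qed.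

Lemma is_derive_prim (n : nat) (g : R -> R -> R) (x t : R) :
  Ck n g -> I01 t -> is_derive (fun y => prim g y t) x (g x t).
Proof.
intros Hg It; apply (is_derive_RInt (fun z => g z t) _ 0).
- exists (mkposreal 1 Rlt_0_1); intros y _; apply @RInt_correct.
  apply (Ck_ex_RInt n); assumption.
- apply (Ck_continuous_slice n); assumption.
Qed.

(** The increment splits into a change of time at fixed endpoint, small by uniform continuity of the
    integrand on a compact interval, and a change of endpoint at fixed time, small by continuity of
    an integral in its upper bound. *)
Lemma prim_continuous (n : nat) (g : R -> R -> R) :
  Ck n g -> forall x t, continuity_2d_pt (fun y s => prim g y (clamp s)) x t.
Proof.
intros Hg x t eps.
(* For [y] within 1 of [x], the integral from 0 to [y] stays inside [-M, M]; an integrand variation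
   of eps / 2 / M then costs at most eps / 2. *)
set (M := Rabs x + 1).
assert (HM : 0 < M) by (unfold M; pose proof (Rabs_pos x); lra).
assert (He : 0 < eps / 2 / M)
  by (apply Rdiv_lt_0_compat; [pose proof (cond_pos eps); lra|exact HM]).
destruct (uniform_continuity_2d_1d (fun y s => g y (clamp s)) (- M) M t
  (fun y _ => Ck_continuous n g Hg y t) (mkposreal _ He)) as [d1 Hd1]; simpl in Hd1.
assert (Hp : continuity_pt (fun y => prim g y (clamp t)) x).
{ apply continuity_pt_filterlim.
  apply (ex_derive_continuous (fun y => prim g y (clamp t)) x).
  exists (g x (clamp t)).
  exact (is_derive_prim n g x (clamp t) Hg (clamp_I01 t)). }
assert (He2 : 0 < eps / 2) by (pose proof (cond_pos eps); lra).
destruct (Hp _ He2) as [d2 [Hd2 H2]]; simpl in H2; unfold Rdist in H2.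
assert (Hm : 0 < Rmin 1 (Rmin d1 d2)).
{ repeat apply Rmin_pos; [lra|apply cond_pos|exact Hd2]. }
exists (mkposreal _ Hm); simpl; intros y s Hy Hs.
pose proof (Rmin_l 1 (Rmin d1 d2)); pose proof (Rmin_r 1 (Rmin d1 d2)).
pose proof (Rmin_l d1 d2); pose proof (Rmin_r d1 d2).
assert (HyM : Rabs y <= M).
{ unfold M; replace y with (x + (y - x)) by ring.
  pose proof (Rabs_triang x (y - x)); lra. }
assert (E1 : ex_RInt (fun z => g z (clamp s)) 0 y)
  by (apply (Ck_ex_RInt n); [exact Hg|apply clamp_I01]).
assert (E2 : ex_RInt (fun z => g z (clamp t)) 0 y)
  by (apply (Ck_ex_RInt n); [exact Hg|apply clamp_I01]).
replace (prim g y (clamp s) - prim g x (clamp t)) with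
  ((prim g y (clamp s) - prim g y (clamp t)) + (prim g y (clamp t) - prim g x (clamp t)))
  by ring.
apply Rle_lt_trans with (1 := Rabs_triang _ _).
assert (A2 : Rabs (prim g y (clamp t) - prim g x (clamp t)) < eps / 2).
{ destruct (Req_dec y x) as [->|Hyx].
  - rewrite Rminus_diag, Rabs_R0; exact He2.
  - apply H2; split; [split; [exact I|]|]; auto; lra. }
assert (A1 : Rabs (prim g y (clamp s) - prim g y (clamp t)) <= eps / 2).
{ unfold prim.
  rewrite <- (RInt_minus (V := R_CompleteNormedModule)) by assumption.
  pose proof (@norm_RInt_le_const_abs R_NormedModule) as HN.
  apply Rle_trans with (Rabs (y - 0) * (eps / 2 / M)).
  - apply (HN (fun z => minus (g z (clamp s)) (g z (clamp t)))).
    + intros z Hz; apply Rlt_le.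
      assert (- M <= z <= M).
      { apply Rabs_le_between in HyM; revert Hz; unfold Rmin, Rmax.
        destruct Rle_dec; lra. }
      pose proof (cond_pos d1); apply Rabs_def2 in Hs.
      apply (Hd1 z t z s); try lra.
      rewrite Rminus_diag, Rabs_R0; lra.
    + apply @RInt_correct, @ex_RInt_minus; assumption.
  - rewrite Rminus_0_r.
    apply Rle_trans with (M * (eps / 2 / M)); [|right; field; lra].
    apply Rmult_le_compat_r; [lra|exact HyM]. }
lra.
Qed.

(** Differentiation under the integral sign requires two-sided differentiability for parameters near
    [t], even when [t] is 0 or 1; hence the integrand is first extended by tangent lines. *)
Lemma is_dt_prim (n : nat) (g : R -> R -> R) (x t : R) :
  Ck (S n) g -> I01 t -> is_dt (prim g) x t (prim (dt g) x t).
Proof.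
intros Hg It.
set (k := fun s z => g z (clamp s) + dt g z (clamp s) * (s - clamp s)).
(* Inside [0,1] this is the tangent extension lemma; outside, [k] is locally affine in time, with
   the slope taken at the nearest endpoint. *)
assert (Hk : forall s z, is_derive (fun s' => k s' z) s (dt g z (clamp s))).
{ intros s z; destruct (Rle_dec 0 s) as [s0|s0]; [destruct (Rle_dec s 1) as [s1|s1]|].
  - assert (Is : I01 s) by (unfold I01; lra); rewrite (clamp_id s Is).
    apply (is_derive_tangent_extension (g z) (dt g z) s Is).
    apply (Ck_is_dt n g z s Hg Is).
  - replace (clamp s) with 1 by (unfold clamp, Rmax, Rmin; repeat destruct Rle_dec; lra).
    apply is_derive_ext_loc with (f := fun s' => g z 1 + dt g z 1 * (s' - 1)).
    + assert (Hs : 0 < s - 1) by lra; exists (mkposreal _ Hs).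
      intros s' Hs'; apply Rabs_def2 in Hs'; unfold minus, plus, opp in Hs'; simpl in Hs'.
      unfold k; replace (clamp s') with 1
        by (unfold clamp, Rmax, Rmin; repeat destruct Rle_dec; lra).
      reflexivity.
    + auto_derive; [exact I|ring].
  - replace (clamp s) with 0 by (unfold clamp, Rmax, Rmin; repeat destruct Rle_dec; lra).
    apply is_derive_ext_loc with (f := fun s' => g z 0 + dt g z 0 * (s' - 0)).
    + assert (Hs : 0 < - s) by lra; exists (mkposreal _ Hs).
      intros s' Hs'; apply Rabs_def2 in Hs'; unfold minus, plus, opp in Hs'; simpl in Hs'.
      unfold k; replace (clamp s') with 0
        by (unfold clamp, Rmax, Rmin; repeat destruct Rle_dec; lra).
      reflexivity.
    + auto_derive; [exact I|ring]. }
apply (is_derive_is_dt _ (fun s => RInt (k s) 0 x)); [exact It| |].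
- replace (prim (dt g) x t) with (RInt (fun z => Derive (fun s => k s z) t) 0 x).
  + apply (is_derive_RInt_param k).
    * exists (mkposreal 1 Rlt_0_1); intros s _ z _; exists (dt g z (clamp s)); apply Hk.
    * intros z _.
      apply continuity_2d_pt_ext with (f := fun s y => dt g y (clamp s)).
      { intros s y; symmetry; apply is_derive_unique, Hk. }
      intros eps; destruct (Ck_continuous n _ (Ck_dt n g Hg) z t eps) as [d Hd].
      exists d; intros s y Hs Hy; apply Hd; assumption.
    * exists (mkposreal 1 Rlt_0_1); intros s _; unfold k.
      apply (ex_RInt_plus (V := R_NormedModule) (fun z => g z (clamp s))
               (fun z => dt g z (clamp s) * (s - clamp s))).
      { apply (Ck_ex_RInt (S n)); [exact Hg|apply clamp_I01]. }
      apply ex_RInt_ext with (f := fun z => scal (s - clamp s) (dt g z (clamp s))).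
      { intros z _; apply Rmult_comm. }
      apply (ex_RInt_scal (V := R_NormedModule)), (Ck_ex_RInt n);
        [apply Ck_dt, Hg|apply clamp_I01].
  + apply RInt_ext; intros z _; rewrite <- (clamp_id t It) at 2.
    apply is_derive_unique, Hk.
- intros s Is; apply RInt_ext; intros z _; unfold k; rewrite (clamp_id s Is).
  change (g z s + dt g z s * (s - s) = g z s); ring.
Qed.

(** The induction closes because the space derivative of [prim g] is [g] itself and its time
    derivative is the primitive of [dt g]. *)
Lemma Ck_prim (n : nat) : forall g : R -> R -> R, Ck n g -> Ck n (prim g).
Proof.
induction n as [|n IH]; intros g Hg.
- apply Ck_0, (prim_continuous 0 g Hg).
- apply (Ck_intro n _ g (prim (dt g))).
  + apply (prim_continuous (S n) g Hg).
  + intros x t It; apply (is_derive_prim (S n)); assumption.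
  + intros x t It; apply (is_dt_prim n); assumption.
  + intros k Hk; exact (Ck_ext n _ _ Hk (Ck_pred n g Hg)).
  + intros k Hk; exact (Ck_ext n _ _ Hk (IH _ (Ck_dt n g Hg))).
Qed.

(** * Recovering functions from space derivatives, mixed derivatives, periodicity *)

Lemma is_derive_0_const (h : R -> R) :
  (forall x, is_derive h x 0) -> forall x, h x = h 0.
Proof.
intros H x; destruct (Rtotal_order x 0) as [Hx|[->|Hx]]; [|reflexivity|].
- apply (eq_is_derive h); [intros y _; apply H|exact Hx].
- symmetry; apply (eq_is_derive h); [intros y _; apply H|exact Hx].
Qed.

(** Regularity is asked of the derivative [v] rather than of [g], so that the formula also covers a
    potential, about whose joint continuity nothing is assumed. *)
Lemma eq_prim_dx (n : nat) (g v : R -> R -> R) (x t : R) :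
  Ck n v -> I01 t -> (forall y, is_derive (fun z => g z t) y (v y t)) ->
  g x t = g 0 t + prim v x t.
Proof.
intros Hv It Hg.
assert (H : g x t - prim v x t = g 0 t - prim v 0 t).
{ apply (is_derive_0_const (fun y => g y t - prim v y t)); intros y.
  replace 0 with (v y t - v y t) by ring.
  apply @is_derive_minus; [apply Hg|apply (is_derive_prim n); assumption]. }
assert (H0 : prim v 0 t = 0) by apply @RInt_point.
lra.
Qed.

(* Differentiating [g = g(0,.) + prim (dx g)] in t and then in x. *)
Lemma dx_dt_comm (g : R -> R -> R) (x t : R) :
  Ck 2 g -> I01 t -> dx (dt g) x t = dt (dx g) x t.
Proof.
intros Hg It.
assert (Hx : Ck 1 (dx g)) by exact (Ck_dx 1 g Hg).
assert (H : forall y, dt g 0 t + prim (dt (dx g)) y t = dt g y t).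
{ intros y; symmetry; apply (is_dt_unique g y t _ It).
  apply (is_dt_ext (fun y s => g 0 s + prim (dx g) y s) g y y t _ It).
  - intros s Is; symmetry; apply (eq_prim_dx 1 g (dx g)); [exact Hx|exact Is|].
    intros z; apply (Ck_is_derive 1 g z s Hg Is).
  - apply (is_dt_plus (fun _ s => g 0 s) (prim (dx g))); [exact It| |].
    + apply (is_dt_ext g _ 0 y t _ It); [reflexivity|apply (Ck_is_dt 1 g 0 t Hg It)].
    + exact (is_dt_prim 0 (dx g) y t Hx It). }
apply is_derive_unique.
apply is_derive_ext with (1 := H).
rewrite <- (Rplus_0_l (dt (dx g) x t)).
apply @is_derive_plus; [apply @is_derive_const|].
apply (is_derive_prim 0); [exact (Ck_dt 0 _ Hx)|exact It].
Qed.

(** The increment over one period has derivative zero because [g] is periodic, and at [x = 0] it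
    equals the integral of [g] over the circle. *)
Lemma periodic_prim (n : nat) (g : R -> R -> R) :
  Ck n g -> periodic g -> (forall t, I01 t -> prim g 1 t = 0) -> periodic (prim g).
Proof.
intros Hg Hp H0 x t It.
assert (H : prim g (x + 1) t - prim g x t = prim g (0 + 1) t - prim g 0 t).
{ apply (is_derive_0_const (fun y => prim g (y + 1) t - prim g y t)); intros y.
  replace 0 with (1 * g (y + 1) t - g y t) by (rewrite (Hp y t It); ring).
  apply @is_derive_minus; [|apply (is_derive_prim n); assumption].
  apply (is_derive_comp (fun z => prim g z t) (fun z => z + 1)).
  - apply (is_derive_prim n); assumption.
  - auto_derive; [exact I|ring]. }
assert (P0 : prim g 0 t = 0) by apply @RInt_point.
rewrite Rplus_0_l, (H0 t It) in H; lra.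
Qed.

Lemma periodic_dt (g : R -> R -> R) :
  smooth g -> periodic g -> periodic (dt g).
Proof.
intros Hg Hp x t It; apply (is_dt_unique _ _ _ _ It).
apply (is_dt_ext g g x (x + 1) t _ It).
- intros s Is; symmetry; apply Hp, Is.
- apply (Ck_is_dt 0 g x t (Hg 1%nat) It).
Qed.

(** * Regularity, periodicity and means of f, Q and q *)

Section GeodesicEquation.

Variable u : R -> R -> R.
Hypothesis u_smooth : smooth u.
Hypothesis u_periodic : periodic u.
Hypothesis u_pos : forall x t, I01 t -> 0 < u x t.
Hypothesis u_mass : forall t, I01 t -> RInt (fun x => u x t) 0 1 = 1.

Let f := dt u.
Let Qf := Q u f.
Let v := q u f.

Lemma u_neq0 (x t : R) : I01 t -> u x t <> 0.
Proof. intros It; apply Rgt_not_eq, u_pos, It. Qed.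

Lemma smooth_inv_u : smooth (fun x t => / u x t).
Proof. intros n; apply Ck_inv; [exact u_neq0|apply u_smooth]. Qed.

Lemma smooth_f : smooth f.
Proof. intros n; apply Ck_dt, u_smooth. Qed.

(** Differentiate the constant total mass under the integral. The zero mean makes Q periodic. *)
Lemma f_mean (t : R) : I01 t -> prim f 1 t = 0.
Proof.
intros It; unfold f; rewrite <- (is_dt_unique _ _ _ _ It (is_dt_prim 0 u 1 t (u_smooth 1%nat) It)).
apply (is_dt_unique _ _ _ _ It).
apply (is_dt_ext (fun _ _ => 1) _ 1 1 t _ It); [|apply is_dt_const, It].
intros s Is; symmetry; apply u_mass, Is.
Qed.

Lemma inv_u_mean_pos (t : R) : I01 t -> 0 < prim (fun x t => / u x t) 1 t.
Proof.
intros It; apply (RInt_gt_0 (fun x => / u x t)); [lra| |].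
- intros x _; apply Rinv_0_lt_compat, u_pos, It.
- intros x _; apply (Ck_continuous_slice 0 _ x t (smooth_inv_u 0%nat) It).
Qed.

Let invu_primf : R -> R -> R := fun x t => / u x t * prim f x t.

(* The function of time subtracted in Q, kept as a function of (x,t) so that the
   calculus of [Ck] applies. *)
Let c : R -> R -> R := fun _ t => prim invu_primf 1 t * / prim (fun x t => / u x t) 1 t.

Lemma smooth_invu_primf : smooth invu_primf.
Proof. intros n; apply Ck_mult; [apply smooth_inv_u|apply Ck_prim, smooth_f]. Qed.

Lemma smooth_c : smooth c.
Proof.
intros n; apply (Ck_mult n (fun _ t => prim invu_primf 1 t)).
- apply (Ck_at 1), Ck_prim, smooth_invu_primf.
- apply Ck_inv.
  + intros _ t It; apply Rgt_not_eq, inv_u_mean_pos, It.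
  + apply (Ck_at 1), Ck_prim, smooth_inv_u.
Qed.

(** By conversion, Q is [prim f] minus [c]. *)
Lemma smooth_Q : smooth Qf.
Proof.
intros n; apply (Ck_plus n (prim f) (fun x t => - c x t)).
- apply Ck_prim, smooth_f.
- apply Ck_opp, smooth_c.
Qed.

Lemma is_derive_Q (x t : R) : I01 t -> is_derive (fun y => Qf y t) x (f x t).
Proof.
intros It; replace (f x t) with (f x t - 0) by ring.
apply (is_derive_minus (fun y => prim f y t) (fun _ => c 0 t)).
- apply (is_derive_prim 0); [apply smooth_f|exact It].
- apply @is_derive_const.
Qed.

(** Since [f] is the space derivative of Q, both sides of the geodesic equation become space
    derivatives. *)
Lemma dt_f (x t : R) : I01 t -> dt f x t = dx (dt Qf) x t.
Proof.
intros It; rewrite (dx_dt_comm Qf x t (smooth_Q 2%nat) It); symmetry.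
apply (is_dt_unique _ _ _ _ It), (is_dt_ext f _ x x t _ It).
- intros s Is; symmetry; apply is_derive_unique, is_derive_Q, Is.
- apply (Ck_is_dt 0 f x t (smooth_f 1%nat) It).
Qed.

Lemma periodic_Q : periodic Qf.
Proof.
intros x t It; unfold Qf, Q; f_equal.
apply (periodic_prim 0 f); [apply smooth_f| |exact f_mean|exact It].
apply periodic_dt; assumption.
Qed.

Lemma smooth_q : smooth v.
Proof.
intros n; apply Ck_mult; [apply Ck_opp, smooth_Q|apply smooth_inv_u].
Qed.

Lemma periodic_q : periodic v.
Proof.
intros x t It; unfold v, q; rewrite (u_periodic x t It).
f_equal; f_equal; apply (periodic_Q x t It).
Qed.

(** The integral of q is [c] times the integral of 1/u, minus the integral of F/u, with F the
    primitive of [f]; [c] is the quotient that makes these cancel. *)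
Lemma q_mean (t : R) : I01 t -> prim v 1 t = 0.
Proof.
intros It.
assert (E1 : ex_RInt (fun x => invu_primf x t) 0 1)
  by (apply (Ck_ex_RInt 0); [apply smooth_invu_primf|exact It]).
assert (E2 : ex_RInt (fun x => / u x t) 0 1)
  by (apply (Ck_ex_RInt 0 (fun x t => / u x t)); [apply smooth_inv_u|exact It]).
assert (E : is_RInt (fun x => v x t) 0 1
  (c 0 t * prim (fun x t => / u x t) 1 t - prim invu_primf 1 t)).
{ apply is_RInt_ext with (f := fun x => c 0 t * / u x t - invu_primf x t).
  - intros x _.
    change (c 0 t * / u x t - / u x t * prim f x t
      = - (prim f x t - c 0 t) * / u x t); ring.
  - apply (is_RInt_minus (V := R_NormedModule) (fun x => c 0 t * / u x t)).
    + apply (is_RInt_scal (V := R_NormedModule) (fun x => / u x t)).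
      exact (RInt_correct _ _ _ E2).
    + exact (RInt_correct _ _ _ E1). }
unfold prim at 1; rewrite (is_RInt_unique _ _ _ _ E).
unfold c; field; apply Rgt_not_eq, inv_u_mean_pos, It.
Qed.

(** * Geodesic, canonical and Burgers equations *)

(** Quotient rule with u_t = Q_x = f: both sides equal - Q_t / u + 2 Q f / u^2 - Q^2 u_x / u^3. *)
Lemma burgers_canonical (x t : R) : I01 t ->
  dt v x t + v x t * dx v x t = - / u x t * (dt Qf x t - Utilde u f x t).
Proof.
intros It; pose proof (u_neq0 x t It) as u0.
assert (Hu : is_derive (fun y => u y t) x (dx u x t))
  by exact (Ck_is_derive 0 u x t (u_smooth 1%nat) It).
pose proof (is_derive_Q x t It) as HQ.
assert (DQ : Derive (fun y => Qf y t) x = f x t) by exact (is_derive_unique _ _ _ HQ).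
assert (Du : Derive (fun y => u y t) x = dx u x t) by reflexivity.
assert (Dt : dt v x t = - dt Qf x t / u x t + Qf x t * f x t / u x t ^ 2).
{ apply (is_dt_unique _ _ _ _ It).
  (* At fixed [x], [a] and [b] stand for Q and u as functions of time that are differentiable on
     both sides of [t], so that ordinary differentiation applies. *)
  destruct (is_dt_extension Qf x t _ It (Ck_is_dt 0 Qf x t (smooth_Q 1%nat) It))
    as [a [Ha Ea]].
  destruct (is_dt_extension u x t _ It (Ck_is_dt 0 u x t (u_smooth 1%nat) It))
    as [b [Hb Eb]].
  apply (is_derive_is_dt _ (fun s => - a s * / b s)); [exact It| |].
  - rewrite <- (Eb t It) in u0.
    rewrite <- (Ea t It), <- (Eb t It).
    auto_derive.
    + repeat split; [exists (dt Qf x t); exact Ha|exists (dt u x t); exact Hb|exact u0].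
    + replace (Derive (fun s => a s) t) with (dt Qf x t)
        by (symmetry; exact (is_derive_unique _ _ _ Ha)).
      replace (Derive (fun s => b s) t) with (f x t)
        by (symmetry; exact (is_derive_unique _ _ _ Hb)).
      field; exact u0.
  - intros s Is; rewrite (Ea s Is), (Eb s Is); reflexivity. }
assert (Dx : dx v x t = - f x t / u x t + Qf x t * dx u x t / u x t ^ 2).
{ apply is_derive_unique; unfold v, q; fold Qf.
  auto_derive.
  - repeat split; [exists (f x t); exact HQ|exists (dx u x t); exact Hu|exact u0].
  - rewrite DQ, Du.
    field; exact u0. }
assert (DU : dx (fun y s => Q u f y s ^ 2 / u y s ^ 2) x t =
  2 * Qf x t * f x t / u x t ^ 2 - 2 * Qf x t ^ 2 * dx u x t / u x t ^ 3).
{ apply is_derive_unique; fold Qf.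
  auto_derive.
  - repeat split; [exists (f x t); exact HQ|exists (dx u x t); exact Hu|].
    intros H; apply u0; nra.
  - rewrite DQ, Du.
    field; exact u0. }
unfold Utilde; rewrite Dt, Dx, DU.
change (v x t) with (- Qf x t * / u x t); fold Qf.
field; exact u0.
Qed.

(* [w] is the left-hand side of the Burgers equation; [u * w] is then [U - Q_t]. *)
Let w : R -> R -> R := fun x t => dt v x t + v x t * dx v x t.

Lemma smooth_w : smooth w.
Proof.
intros n; apply Ck_plus; [apply Ck_dt, smooth_q|].
apply Ck_mult; [|apply Ck_dx]; apply smooth_q.
Qed.

Lemma is_derive_half_sqr_q (x t : R) : I01 t ->
  is_derive (fun y => v y t ^ 2 / 2) x (v x t * dx v x t).
Proof.
intros It; pose proof (Ck_is_derive 0 v x t (smooth_q 1%nat) It) as H.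
auto_derive; [exists (dx v x t); exact H|].
change (Derive (fun y => v y t) x) with (dx v x t); field.
Qed.

(** This explicit space primitive of [w] yields both the zero mean of [w] and the link with the
    Hamilton-Jacobi equation. *)
Lemma is_derive_burgers_potential (x t : R) : I01 t ->
  is_derive (fun y => prim (dt v) y t + v y t ^ 2 / 2) x (w x t).
Proof.
intros It; apply @is_derive_plus; [|apply is_derive_half_sqr_q, It].
apply (is_derive_prim 0); [apply Ck_dt, smooth_q|exact It].
Qed.

(** Integrating [w] over a period leaves the time derivative of the mean of q, which is zero, and
    the increment of q^2 / 2, which vanishes by periodicity. *)
Lemma w_mean (t : R) : I01 t -> prim w 1 t = 0.
Proof.
intros It.
pose proof (eq_prim_dx 0 (fun y s => prim (dt v) y s + v y s ^ 2 / 2) w 1 t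
  (smooth_w 0%nat) It (fun y => is_derive_burgers_potential y t It)) as H.
simpl in H.
assert (H1 : prim (dt v) 1 t = 0).
{ rewrite <- (is_dt_unique _ _ _ _ It (is_dt_prim 0 v 1 t (smooth_q 1%nat) It)).
  apply (is_dt_unique _ _ _ _ It).
  apply (is_dt_ext (fun _ _ => 0) _ 1 1 t _ It); [|apply is_dt_const, It].
  intros s Is; symmetry; apply q_mean, Is. }
assert (H0 : prim (dt v) 0 t = 0) by apply @RInt_point.
assert (Hp : v 1 t = v 0 t)
  by (rewrite <- (periodic_q 0 t It), Rplus_0_l; reflexivity).
rewrite Hp in H; lra.
Qed.

Lemma Utilde_w (x t : R) : I01 t -> Utilde u f x t = dt Qf x t + u x t * w x t.
Proof.
intros It; unfold w; rewrite (burgers_canonical x t It); field; exact (u_neq0 x t It).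
Qed.

Lemma canonical_geodesic : canonical_eq u f -> geodesic_eq u f.
Proof.
intros H x t It; rewrite (dt_f x t It); apply Derive_ext; intros y; apply H, It.
Qed.

(** The geodesic equation makes u w equal to some C(t). Dividing by u and integrating gives 0 = C
    times the integral of 1/u, which is positive, so C = 0. *)
Lemma geodesic_canonical : geodesic_eq u f -> canonical_eq u f.
Proof.
intros H x t It.
assert (Hc : forall y, u y t * w y t = u 0 t * w 0 t).
{ apply (is_derive_0_const (fun y => u y t * w y t)); intros y.
  (* Differentiability of U has to be established, as [Derive] alone does not guarantee it; it is
     read off from U = Q_t + u w, whose terms are smooth. *)
  assert (HU : is_derive (fun z => Utilde u f z t) y (dx (Utilde u f) y t)).
  { apply Derive_correct, ex_derive_ext
      with (f := fun z => dt Qf z t + u z t * w z t).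
    - intros z; symmetry; apply Utilde_w, It.
    - eexists; apply (Ck_is_derive 0 (fun z s => dt Qf z s + u z s * w z s));
        [|exact It].
      apply Ck_plus; [apply Ck_dt, smooth_Q|].
      apply Ck_mult; [apply u_smooth|apply smooth_w]. }
  apply is_derive_ext with (f := fun z => Utilde u f z t - dt Qf z t).
  { intros z; rewrite (Utilde_w z t It).
    change (dt Qf z t + u z t * w z t - dt Qf z t = u z t * w z t); ring. }
  replace 0 with (dx (Utilde u f) y t - dx (dt Qf) y t).
  - apply @is_derive_minus; [exact HU|].
    apply (Ck_is_derive 0); [apply Ck_dt, smooth_Q|exact It].
  - rewrite <- (dt_f y t It), (H y t It); ring. }
assert (Hw : prim w 1 t = u 0 t * w 0 t * prim (fun x t => / u x t) 1 t).
{ apply is_RInt_unique.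
  apply is_RInt_ext with (f := fun y => u 0 t * w 0 t * / u y t).
  - intros y _; rewrite <- (Hc y).
    change (u y t * w y t * / u y t = w y t); field; exact (u_neq0 y t It).
  - apply (is_RInt_scal (V := R_NormedModule) (fun x => / u x t)).
    apply (RInt_correct (fun x => / u x t)).
    apply (Ck_ex_RInt 0 (fun x t => / u x t)); [apply smooth_inv_u|exact It]. }
rewrite (w_mean t It) in Hw; symmetry in Hw.
apply Rmult_integral in Hw; destruct Hw as [Hw|Hw].
- rewrite (Utilde_w x t It), Hc, Hw; unfold Qf; ring.
- pose proof (inv_u_mean_pos t It); lra.
Qed.

Lemma canonical_iff_burgers : canonical_eq u f <-> burgers_eq v.
Proof.
split; intros H x t It.
- rewrite (burgers_canonical x t It).
  unfold Qf; rewrite (H x t It); ring.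
- rewrite (Utilde_w x t It); unfold w; rewrite (H x t It); unfold Qf; ring.
Qed.

(** * Potentials of q and the Hamilton-Jacobi equation *)

(** The primitive of q from 0 closes up over a period because q has zero mean. *)
Lemma potential_exists : exists phi, smooth phi /\ potential v phi.
Proof.
exists (prim v); split; [intros n; apply Ck_prim, smooth_q|split].
- apply (periodic_prim 0); [apply smooth_q|exact periodic_q|exact q_mean].
- intros x t It; split; [apply (is_derive_prim 0); [apply smooth_q|exact It]|].
  exists (prim (dt v) x t); apply (is_dt_prim 0); [apply smooth_q|exact It].
Qed.

(** Writing phi = phi(0,t) + [prim v] and differentiating in time shows that the Hamilton-Jacobi
    expression is phi_t(0,t) plus the primitive of [w] found above. It is therefore constant in
    space exactly when [w] vanishes. *)
Lemma burgers_iff_hamilton_jacobi (phi : R -> R -> R) :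
  potential v phi -> (burgers_eq v <-> hamilton_jacobi_eq phi).
Proof.
intros [_ Hphi].
assert (Dx : forall x t, I01 t -> dx phi x t = v x t)
  by (intros x t It; apply is_derive_unique, Hphi, It).
assert (Dt : forall x t, I01 t -> dt phi x t = dt phi 0 t + prim (dt v) x t).
{ intros x t It; apply (is_dt_unique _ _ _ _ It).
  apply (is_dt_ext (fun y s => phi 0 s + prim v y s) _ x x t _ It).
  - intros s Is; symmetry; apply (eq_prim_dx 0); [apply smooth_q|exact Is|].
    intros y; apply Hphi, Is.
  - apply (is_dt_plus (fun _ s => phi 0 s) (prim v)); [exact It| |].
    + apply (is_dt_ext phi _ 0 x t _ It); [reflexivity|].
      apply is_dt_dt; [exact It|apply Hphi, It].
    + apply (is_dt_prim 0); [apply smooth_q|exact It]. }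
split; intros H.
- intros x t It; rewrite (Dt x t It), !Dx, !pow2_abs by exact It.
  assert (Hc : prim (dt v) x t + v x t ^ 2 / 2 = prim (dt v) 0 t + v 0 t ^ 2 / 2).
  { apply (is_derive_0_const (fun y => prim (dt v) y t + v y t ^ 2 / 2)); intros y.
    rewrite <- (H y t It); apply (is_derive_burgers_potential y t It). }
  assert (H0 : prim (dt v) 0 t = 0) by apply @RInt_point.
  lra.
- intros x t It; change (w x t = 0).
  rewrite <- (is_derive_unique _ _ _ (is_derive_burgers_potential x t It)).
  (* The constant is the value at [x = 0], where [prim (dt v)] vanishes. *)
  rewrite <- (Derive_const (v 0 t ^ 2 / 2) x); apply Derive_ext; intros y.
  specialize (H y t It); cbv beta zeta in H.
  rewrite (Dt y t It), !Dx, !pow2_abs in H by exact It.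
  lra.
Qed.

End GeodesicEquation.

Theorem lemma5p17 (u : R -> R -> R)
  (u_smooth : smooth u) (u_periodic : periodic u)
  (u_pos : forall x t, I01 t -> 0 < u x t)
  (u_mass : forall t, I01 t -> RInt (fun x => u x t) 0 1 = 1) :
  let f := dt u in
  (geodesic_eq u f <-> canonical_eq u f) /\
  (geodesic_eq u f <-> burgers_eq (q u f)) /\
  ((exists phi, smooth phi /\ potential (q u f) phi) /\
   forall phi, potential (q u f) phi ->
     (geodesic_eq u f <-> hamilton_jacobi_eq phi)).
Proof.
intros f.
assert (H1 : geodesic_eq u f <-> canonical_eq u f)
  by (split; [apply geodesic_canonical|apply canonical_geodesic]; assumption).
assert (H2 : canonical_eq u f <-> burgers_eq (q u f))
  by (apply canonical_iff_burgers; assumption).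
split; [exact H1|]; split; [tauto|]; split.
- apply potential_exists; assumption.
- intros phi Hphi.
  assert (H3 : burgers_eq (q u f) <-> hamilton_jacobi_eq phi)
    by (apply burgers_iff_hamilton_jacobi; assumption).
  tauto.
Qed.
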